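(* Let $y\in\mathbb{R}^N$ be a unit vector with $y\notin\mathcal{R}_{\ell}$, let $i\ge 1$ be an iteration index reached by LSQRNV started from $y$, and suppose that the scalar $\Delta_i$ defined in the context satisfies $\Delta_i\epsilon^2<1$. Then the $i$th iterate $x_i$ produced by LSQRNV satisfies $$\sin\angle(\mathcal{N}_{\epsilon},x_i)\;\le\;\frac{2\tan\angle(\mathcal{N}_{\epsilon},y)}{1-\Delta_i\epsilon^2}\left(\frac{\kappa-1}{\kappa+1}\right)^{i}+\frac{2\sqrt{\Delta_i}\,\epsilon}{1-\Delta_i\epsilon^2}.$$
   Context: Matrix setting. $A\in\mathbb{R}^{M\times N}$ has singular values $\sigma_1\ge\dots\ge\sigma_N\ge 0$ (the nonnegative square roots of the eigenvalues of $A^TA$), normalized so that $\sigma_1=1$. Fix $1\le\ell<N$ with $\sigma_\ell>\sigma_{\ell+1}$ (the numerical rank) and put $\kappa=\sigma_1/\sigma_\ell$ (numerical condition number) and $\epsilon=\sigma_{\ell+1}/\sigma_1$. Let $W=[W_\ell,W_\epsilon]\in\mathbb{R}^{N\times N}$ be an orthogonal matrix of right singular vectors, with $W_\ell$ having $\ell$ columns, so that $A^TA=W_\ell\Sigma_\ell^2W_\ell^T+W_\epsilon\Sigma_\epsilon^2W_\epsilon^T$, where $\Sigma_\ell=\mathrm{diag}(\sigma_1,\dots,\sigma_\ell)$ and $\Sigma_\epsilon=\mathrm{diag}(\sigma_{\ell+1},\dots,\sigma_N)$. Define $\mathcal{R}_\ell=\mathrm{span}(W_\ell)$ (numerical range space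 of $A^T$) and $\mathcal{N}_\epsilon=\mathrm{span}(W_\epsilon)$ (numerical null space of $A$). $\|\cdot\|$ is the Euclidean/spectral norm. For a nonzero vector $v$, $\angle(\mathcal{N}_\epsilon,v)\in[0,\pi/2]$ is the acute angle: $\sin\angle(\mathcal{N}_\epsilon,v)=\|W_\ell^Tv\|/\|v\|$, $\cos\angle(\mathcal{N}_\epsilon,v)=\|W_\epsilon^Tv\|/\|v\|$. LSQRNV iterates (exact arithmetic). Started from the unit vector $y$, the $i$th iterate is $x_i=y-A^Tz_i$, where $z_i$ minimizes $\|y-A^T\tilde z\|$ over $\tilde z$ in the Krylov subspace $\mathcal{U}_i=\mathrm{span}\{Ay,(AA^T)Ay,\dots,(AA^T)^{i-1}Ay\}$. An index $i$ is reached if there is no breakdown before it, so $\dim\mathcal{U}_i=i$. Polynomials. Let $\Psi_i$ be the set of real polynomials $\psi$ of degree at most $i$ with $\psi(0)=1$. Let $\psi_i\in\Psi_i$ be a minimizer of $\|\psi(A^TA)y\|$ over $\psi\in\Psi_i$, so that $x_i=\psi_i(A^TA)y$. With $g_\ell=W_\ell^Ty$, let $\widehat\psi_i\in\Psi_i$ be a (fixed) minimizer of $\|\psi(\Sigma_\ell^2)g_\ell\|$ over $\psi\in\Psi_i$. Let $\phi_i,\hat\phi_i$ be the polynomials of degree at most $i-1$ with $\psi_i(\varsigma)=1+\varsigma\phi_i(\varsigma)$ and $\widehat\psi_i(\varsigma)=1+\varsigma\hat\phi_i(\varsigma)$. Define $$\Delta_i=\max\Big\{\max_{0\le\varsigma\le\epsilon^2}|\phi_i(\varsigma)|,\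 \max_{0\le\varsigma\le\epsilon^2}|\hat\phi_i(\varsigma)|\Big\}.$$ *)

(* Defs.v *)
From HB Require Import structures.
From mathcomp Require Export all_boot all_order all_algebra.
From mathcomp Require Export all_classical all_reals all_analysis.

Set Implicit Arguments.
Unset Strict Implicit.
Unset Printing Implicit Defensive.

Export Order.TTheory GRing.Theory Num.Theory.

Local Open Scope classical_set_scope.
Local Open Scope ring_scope.

(* The norm `|v| that the library puts on matrices is the max norm, hence this
   separate Euclidean norm on column vectors. *)
Definition enorm (R : realType) (n : nat) (v : 'cV[R]_n) : R :=
  Num.sqrt (\sum_(j < n) v j 0 ^+ 2).

Definition is_minimizer (R : realType) (T : Type) (S : set T) (f : T -> R)
    (a : T) : Prop :=
  S a /\ forall b, S b -> f a <= f b.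

(* Singular values are listed with multiplicity and indexed from 0: sigma`_0 is
   sigma_1.  The number of them is the number of columns of A. *)
Definition singular_values (R : realType) (m n : nat) (A : 'M[R]_(m, n))
    (sigma : n.-tuple R) : Prop :=
  [/\ char_poly (A^T *m A) = \prod_(s <- sigma) ('X - (s ^+ 2)%:P),
      all (fun s => 0 <= s) sigma
    & sorted (fun s t => t <= s) sigma].

Section Blocks.
(* The numerical rank is l.+1 and the number of columns is l.+1 + k.+1, so that
   the rank ranges over 1, ..., N - 1; sigma`_l and sigma`_l.+1 are the
   singular values on either side of the gap. *)
Variables (R : realType) (l k : nat).
Implicit Types (sigma : (l.+1 + k.+1).-tuple R) (W : 'M[R]_(l.+1 + k.+1)).

Definition Sigma_l sigma : 'M[R]_l.+1 :=
  diag_mx (\row_(j < l.+1) sigma`_j).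

Definition Sigma_eps sigma : 'M[R]_k.+1 :=
  diag_mx (\row_(j < k.+1) sigma`_(l.+1 + j)).

Definition W_l W : 'M[R]_(l.+1 + k.+1, l.+1) := lsubmx W.

Definition W_eps W : 'M[R]_(l.+1 + k.+1, k.+1) := rsubmx W.

Definition right_singular_vectors (m : nat) (A : 'M[R]_(m, l.+1 + k.+1))
    sigma W : Prop :=
  W^T *m W = 1%:M /\
  A^T *m A = W_l W *m Sigma_l sigma ^+ 2 *m (W_l W)^T
           + W_eps W *m Sigma_eps sigma ^+ 2 *m (W_eps W)^T.

Definition range_space W : {vspace 'cV[R]_(l.+1 + k.+1)} :=
  <<[seq col j (W_l W) | j : 'I_l.+1]>>%VS.

(* The angle between v <> 0 and the span of W_eps.  For orthogonal W the
   quotient lies in [0, 1], the angle lies in [0, pi / 2], and its cosine is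
   enorm ((W_eps W)^T *m v) / enorm v. *)
Definition angle W (v : 'cV[R]_(l.+1 + k.+1)) : R :=
  asin (enorm ((W_l W)^T *m v) / enorm v).

End Blocks.

Definition krylov (R : realType) (m n : nat) (A : 'M[R]_(m, n)) (y : 'cV[R]_n)
    (i : nat) : {vspace 'cV[R]_m} :=
  <<[seq (A *m A^T) ^+ j *m (A *m y) | j <- iota 0 i]>>%VS.

Definition reached (R : realType) (m n : nat) (A : 'M[R]_(m, n))
    (y : 'cV[R]_n) (i : nat) : Prop :=
  \dim (krylov A y i) = i.

Definition lsqrnv_iterate (R : realType) (m n : nat) (A : 'M[R]_(m, n))
    (y : 'cV[R]_n) (i : nat) (x : 'cV[R]_n) : Prop :=
  exists z : 'cV[R]_m,
    is_minimizer [set z' | z' \in krylov A y i]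
                 (fun z' => enorm (y - A^T *m z')) z
    /\ x = y - A^T *m z.

Definition Psi (R : realType) (i : nat) : set {poly R} :=
  [set p : {poly R} | (size p <= i.+1)%N /\ p.[0] = 1].

Definition minimizing_poly (R : realType) (n : nat) (B : 'M[R]_n.+1)
    (v : 'cV[R]_n.+1) (i : nat) (p : {poly R}) : Prop :=
  is_minimizer (@Psi R i) (fun q => enorm (horner_mx B q *m v)) p.

(* The supremum is attained when 0 <= b, by compactness of [0, b]. *)
Definition max_abs (R : realType) (p : {poly R}) (b : R) : R :=
  sup [set `|p.[t]| | t in `[0, b]%classic].

(* Main.v *)
Require Import Defs.
From mathcomp Require Import zify ring lra.

Set Implicit Arguments.
Unset Strict Implicit.
Unset Printing Implicit Defensive.

Import numFieldNormedType.Exports.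

Local Open Scope ring_scope.

(** Write [g] and [h] for the components of [y] along the numerical range space and
    the numerical null space. Since [x = psi (A^T A) y], its components are
    [psi (Sigma_l^2) g] and [psi (Sigma_eps^2) h] ([horner_gram_blocks]), and the
    sine of the angle is the norm of the first over the norm of [x].

    On [0, eps^2] both [psi] and [psih] have absolute values between
    [1 - Delta eps^2] and [1 + Delta eps^2] ([residual_bounds]). Hence [x] has norm at least
    [(1 - Delta eps^2) |h|], which accounts for the denominators. As [psi]
    minimizes the sum of the squares of both blocks, comparison with [psih] gives
    [|psi (Sigma_l^2) g|^2 <= |psih (Sigma_l^2) g|^2 + 4 Delta eps^2 |h|^2]
    ([W_l_block_bound]); taking square roots gives the two terms. The first one is
    controlled by the minimality of [psih]: a Chebyshev polynomial carried to
    [sigma_l^2, 1] has absolute values at most [2 ((kappa - 1) / (kappa + 1))^i] there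
    ([small_residual_poly], [min_block_bound]). The quotient [|g| / |h|] is
    the tangent for [y], and [h] is nonzero because [y] is outside the range space.

    The identity [x = psi (A^T A) y] holds because the iterate and the minimizing
    polynomial both give the shortest vector of one affine space
    ([iterate_minimizing_poly]). *)

(** * Chebyshev polynomials and small polynomials normalized at the origin *)

Fixpoint chebyshev (R : realType) (n : nat) : {poly R} :=
  match n with
  | 0 => 1
  | n1.+1 => match n1 with
    | 0 => 'X
    | n2.+1 => 2%:P * 'X * chebyshev R n1 - chebyshev R n2
    end
  end.

Lemma chebyshevSS (R : realType) n :
  chebyshev R n.+2 = 2%:P * 'X * chebyshev R n.+1 - chebyshev R n.
Proof. by []. Qed.

Lemma horner_chebyshev_uniq (R : realType) (t : R) (f : nat -> R) :
  f 0 = 1 -> f 1 = t -> (forall n, f n.+2 = 2 * t * f n.+1 - f n) ->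
  forall n, (chebyshev R n).[t] = f n.
Proof.
move=> f0 f1 fS n.
suff: (chebyshev R n).[t] = f n /\ (chebyshev R n.+1).[t] = f n.+1 by case.
elim: n => [|n [IH1 IH2]]; first by rewrite f0 f1 /= hornerC hornerX.
split=> //; rewrite fS -IH1 -IH2.
by rewrite chebyshevSS hornerD hornerN !hornerM hornerC hornerX.
Qed.

Lemma size_chebyshev (R : realType) n : (size (chebyshev R n) <= n.+1)%N.
Proof.
suff: (size (chebyshev R n) <= n.+1)%N /\ (size (chebyshev R n.+1) <= n.+2)%N.
  by case.
elim: n => [|n [IH1 IH2]]; first by rewrite /= size_poly1 size_polyX.
split=> //; rewrite chebyshevSS.
apply: (leq_trans (size_polyD _ _)); rewrite geq_max size_polyN.
apply/andP; split; last by apply: (leq_trans IH1); rewrite ltnW.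
rewrite mul_polyC -scalerAl; apply: (leq_trans (size_scale_leq _ _)).
apply: (leq_trans (size_polyMleq _ _)); rewrite size_polyX.
by move: IH2; lia.
Qed.

(** On [-1, 1] the identity T_n (cos a) = cos (n a) applies. *)
Lemma chebyshev_le1 (R : realType) n (t : R) :
  -1 <= t <= 1 -> `|(chebyshev R n).[t]| <= 1.
Proof.
move=> t1; set a := acos t.
have ca : cos a = t by rewrite /a acosK // in_itv.
rewrite (@horner_chebyshev_uniq R t (fun n => cos (n%:R * a))).
- by rewrite ler_norml cos_geN1 cos_le1.
- by rewrite mul0r cos0.
- by rewrite mul1r.
move=> j.
have -> : j.+2%:R * a = j.+1%:R * a + a by rewrite -addn1 natrD mulrDl mul1r.
have -> : j%:R * a = j.+1%:R * a - a by rewrite -addn1 natrD mulrDl mul1r addrK.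
by rewrite cosD cosB ca; ring.
Qed.

(** Outside [-1, 1] the cosine identity becomes the one for hyperbolic
    functions, with [w] in the role of an exponential. *)
Lemma chebyshev_joukowski (R : realType) n (w : R) : w != 0 ->
  (chebyshev R n).[(w + w^-1) / 2] = (w ^+ n + w^-1 ^+ n) / 2.
Proof.
move=> w0; apply: (horner_chebyshev_uniq (f := fun n => (w ^+ n + w^-1 ^+ n) / 2)).
- by rewrite !expr0; field.
- by rewrite !expr1.
move=> j; rewrite !exprS.
move: (w ^+ j) (w^-1 ^+ j) => u v; field; exact: w0.
Qed.

(** The least possible maximum on [c^2, 1] is reached by the Chebyshev polynomial
    carried to that interval by an affine map and divided by its value at
    the origin.  The origin is sent to [(1 + c^2) / (1 - c^2)], which is the
    half-sum of [(1 + c) / (1 - c)] and its inverse, hence a growth like the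
    [n]-th power of the latter quotient.  For [c = 1] the interval is a point. *)
Lemma small_residual_poly (R : realType) n (c : R) : 0 < c <= 1 ->
  exists2 q, Psi n q &
    forall t, c ^+ 2 <= t <= 1 -> `|q.[t]| <= 2 * ((1 - c) / (1 + c)) ^+ n.
Proof.
case/andP=> c0; rewrite le_eqVlt => /orP[/eqP->|c1].
  exists ((1 - 'X) ^+ n); first split.
  - apply: (leq_trans (size_poly_exp_leq _ _)).
    rewrite -opprB size_polyN size_XsubC /=; lia.
  - by rewrite horner_exp !hornerE subr0 expr1n.
  move=> t; rewrite expr1n -eq_le => /eqP <-.
  rewrite horner_exp !hornerE subrr mul0r normrX normr0.
  by apply: ler_peMl; rewrite ?exprn_ge0 // ler1n.
pose d := 1 - c ^+ 2.
have d0 : 0 < d by rewrite /d; nra.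
pose L : {poly R} := (- 2 / d) *: 'X + ((1 + c ^+ 2) / d)%:P.
have LE t : L.[t] = (1 + c ^+ 2 - 2 * t) / d.
  by rewrite /L !hornerE; field; rewrite gt_eqF.
pose w := (1 + c) / (1 - c).
have w0 : 0 < w by rewrite divr_gt0; lra.
pose T0 := (chebyshev R n).[L.[0]].
have T0E : T0 = (w ^+ n + w^-1 ^+ n) / 2.
  rewrite -chebyshev_joukowski ?gt_eqF // /T0 LE; congr _.[_].
  rewrite /w /d; field; apply/and3P; split; apply/eqP; nra.
have T0_ge : w ^+ n / 2 <= T0.
  by rewrite T0E ler_pM2r ?invr_gt0 // lerDl exprn_ge0 // invr_ge0 ltW.
have T0_gt0 : 0 < T0 by apply: lt_le_trans T0_ge; rewrite divr_gt0 ?exprn_gt0.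
exists (T0^-1 *: (chebyshev R n \Po L)); first split.
- apply: (leq_trans (size_scale_leq _ _)).
  apply: (leq_trans (size_comp_poly_leq _ _)).
  have sL : (size L <= 2)%N.
    apply: (leq_trans (size_polyD _ _)); rewrite geq_max.
    rewrite (leq_trans (size_scale_leq _ _)) ?size_polyX //=.
    by rewrite (leq_trans (size_polyC_leq1 _)).
  have := size_chebyshev R n; nia.
- by rewrite hornerZ horner_comp mulVf // gt_eqF.
move=> t /andP[ct t1].
rewrite hornerZ horner_comp normrM normfV (gtr0_norm T0_gt0).
have -> : 2 * ((1 - c) / (1 + c)) ^+ n = (w ^+ n / 2)^-1.
  by rewrite invf_div -exprVn /w invf_div.
apply: (@le_trans _ _ T0^-1).
  rewrite ler_piMr ?invr_ge0 1?(ltW T0_gt0) //; apply: chebyshev_le1.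
  rewrite LE ler_pdivlMr // ler_pdivrMr //.
  by apply/andP; rewrite /d; split; nra.
by rewrite lef_pV2 // posrE divr_gt0 ?exprn_gt0.
Qed.

(** * The Euclidean norm *)

Lemma enorm_ge0 (R : realType) n (v : 'cV[R]_n) : 0 <= enorm v.
Proof. exact: sqrtr_ge0. Qed.

Lemma sqr_enorm (R : realType) n (v : 'cV[R]_n) :
  enorm v ^+ 2 = \sum_(j < n) v j 0 ^+ 2.
Proof. by rewrite sqr_sqrtr // sumr_ge0 // => j _; rewrite sqr_ge0. Qed.

Lemma sqr_enorm_mx (R : realType) n (v : 'cV[R]_n) :
  enorm v ^+ 2 = (v^T *m v) 0 0.
Proof.
by rewrite sqr_enorm mxE; apply: eq_bigr => j _; rewrite mxE expr2.
Qed.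

Lemma enorm_eq0 (R : realType) n (v : 'cV[R]_n) : enorm v = 0 -> v = 0.
Proof.
move=> v0; have /eqP := sqr_enorm v; rewrite v0 expr0n eq_sym psumr_eq0; last first.
  by move=> j _; rewrite sqr_ge0.
move=> /allP vj; apply/colP => j; apply/eqP; rewrite mxE.
by have := vj j; rewrite mem_index_enum sqrf_eq0; apply.
Qed.

Lemma enorm_le_sqr (R : realType) m n (u : 'cV[R]_m) (v : 'cV[R]_n) :
  (enorm u <= enorm v) = (enorm u ^+ 2 <= enorm v ^+ 2).
Proof. by rewrite ler_sqr // nnegrE enorm_ge0. Qed.

(** By the parallelogram identity, the midpoint of two distinct vectors of equal norm
    is strictly shorter than both. *)
Lemma shortest_uniq (R : realType) n (S : set 'cV[R]_n) (u v : 'cV[R]_n) :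
  S (2^-1 *: (u + v)) -> is_minimizer S (@enorm R n) u ->
  is_minimizer S (@enorm R n) v -> u = v.
Proof.
move=> Sm [Su umin] [Sv vmin].
have uv : enorm u = enorm v by apply: le_anti; rewrite umin ?vmin.
have := umin _ Sm; rewrite enorm_le_sqr => um.
have par : enorm u ^+ 2 + enorm v ^+ 2
    = 2 * enorm (2^-1 *: (u + v)) ^+ 2 + 2^-1 * enorm (u - v) ^+ 2.
  rewrite !sqr_enorm !mulr_sumr -!big_split /=; apply: eq_bigr => j _.
  by rewrite !mxE; field.
apply/eqP; rewrite -subr_eq0; apply/eqP/enorm_eq0/eqP.
rewrite -sqrf_eq0 eq_le sqr_ge0 andbT; rewrite -uv in par; lra.
Qed.

Section OrthogonalSplitting.
Variables (R : realType) (l k : nat) (W : 'M[R]_(l.+1 + k.+1)).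
Hypothesis W_orth : W^T *m W = 1%:M.

Lemma W_orth_blocks :
  [/\ (W_l W)^T *m W_l W = 1%:M, (W_l W)^T *m W_eps W = 0,
      (W_eps W)^T *m W_l W = 0 & (W_eps W)^T *m W_eps W = 1%:M].
Proof.
have : (row_mx (W_l W) (W_eps W))^T *m row_mx (W_l W) (W_eps W) = 1%:M.
  by rewrite hsubmxK.
by rewrite tr_row_mx mul_col_row scalar_mx_block => /eq_block_mx[].
Qed.

Lemma W_orth_sum : W_l W *m (W_l W)^T + W_eps W *m (W_eps W)^T = 1%:M.
Proof.
by rewrite -mul_row_col -tr_row_mx hsubmxK mulmx1C.
Qed.

Lemma sqr_enorm_split (v : 'cV[R]_(l.+1 + k.+1)) :
  enorm v ^+ 2 = enorm ((W_l W)^T *m v) ^+ 2 + enorm ((W_eps W)^T *m v) ^+ 2.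
Proof.
rewrite !sqr_enorm_mx -[v^T in LHS]mulmx1 -W_orth_sum mulmxDr mulmxDl.
by rewrite [LHS]mxE !trmx_mul !trmxK !mulmxA.
Qed.

Lemma enorm_W_l_le (v : 'cV[R]_(l.+1 + k.+1)) : enorm ((W_l W)^T *m v) <= enorm v.
Proof. by rewrite enorm_le_sqr sqr_enorm_split lerDl sqr_ge0. Qed.

Lemma enorm_W_eps_le (v : 'cV[R]_(l.+1 + k.+1)) :
  enorm ((W_eps W)^T *m v) <= enorm v.
Proof. by rewrite enorm_le_sqr sqr_enorm_split lerDr sqr_ge0. Qed.

Lemma notin_range_space (y : 'cV[R]_(l.+1 + k.+1)) :
  y \notin range_space W -> 0 < enorm ((W_eps W)^T *m y).
Proof.
move=> yR; rewrite lt_def enorm_ge0 andbT; apply: contra yR => /eqP/enorm_eq0 h0.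
have -> : y = W_l W *m ((W_l W)^T *m y).
  by rewrite -[LHS]mul1mx -W_orth_sum mulmxDl -!mulmxA h0 mulmx0 addr0.
have -> : W_l W *m ((W_l W)^T *m y)
    = \sum_j ((W_l W)^T *m y) j 0 *: col j (W_l W).
  apply/colP => r; rewrite mxE summxE; apply: eq_bigr => j _.
  by rewrite [RHS]mxE [col _ _ _ _]mxE mulrC.
by apply: rpred_sum => j _; apply/rpredZ/memv_span/map_f; rewrite mem_enum.
Qed.

Lemma sin_angle (v : 'cV[R]_(l.+1 + k.+1)) : 0 < enorm v ->
  sin (angle W v) = enorm ((W_l W)^T *m v) / enorm v.
Proof.
move=> v0; rewrite asinK // in_itv /= ler_pdivrMr // mul1r enorm_W_l_le andbT.
by rewrite (@le_trans _ _ 0) ?divr_ge0 ?enorm_ge0 // oppr_le0.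
Qed.

Lemma tan_angle (v : 'cV[R]_(l.+1 + k.+1)) : 0 < enorm v ->
  tan (angle W v) = enorm ((W_l W)^T *m v) / enorm ((W_eps W)^T *m v).
Proof.
move=> v0; rewrite /tan sin_angle // cos_asin; last first.
  rewrite ler_pdivrMr // mul1r enorm_W_l_le andbT.
  by rewrite (@le_trans _ _ 0) ?divr_ge0 ?enorm_ge0 // oppr_le0.
have -> : 1 - (enorm ((W_l W)^T *m v) / enorm v) ^+ 2
    = (enorm ((W_eps W)^T *m v) / enorm v) ^+ 2.
  have := sqr_enorm_split v; rewrite !expr_div_n => /eqP.
  rewrite addrC -subr_eq => /eqP <-.
  by field; rewrite gt_eqF.
rewrite sqrtr_sqr ger0_norm ?divr_ge0 ?enorm_ge0 //.
by rewrite invf_div mulrA divfK // gt_eqF.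
Qed.

End OrthogonalSplitting.

(** * Polynomials of matrices *)

(** Taken with the transposed blocks of singular vectors for [X], this replaces a
    diagonalization of the Gram matrix. *)
Lemma horner_mx_intertwine (R : realType) p q (X : 'M[R]_(p.+1, q.+1))
    (B : 'M[R]_q.+1) (C : 'M[R]_p.+1) (f : {poly R}) :
  X *m B = C *m X -> X *m horner_mx B f = horner_mx C f *m X.
Proof.
move=> XB; elim/poly_ind: f => [|f c IH]; first by rewrite !rmorph0 mulmx0 mul0mx.
rewrite !rmorphD !rmorphM /= !horner_mx_X !horner_mx_C mulmxDr mulmxDl.
by rewrite -![_ * _]/(_ *m _) mulmxA IH -!mulmxA XB scalar_mxC.
Qed.

Lemma horner_sqr_diag (R : realType) n (d : 'rV[R]_n.+1) (f : {poly R})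
    (v : 'cV[R]_n.+1) j :
  (horner_mx (diag_mx d ^+ 2) f *m v) j 0 = f.[d 0 j ^+ 2] * v j 0.
Proof.
rewrite expr2 -[_ * _]/(_ *m _) mulmx_diag horner_mx_diag mul_diag_mx.
by rewrite !mxE expr2.
Qed.

Lemma horner_sqr_diag_le (R : realType) n (d : 'rV[R]_n.+1) (f : {poly R})
    (v : 'cV[R]_n.+1) (b : R) :
  0 <= b -> (forall j, `|f.[d 0 j ^+ 2]| <= b) ->
  enorm (horner_mx (diag_mx d ^+ 2) f *m v) <= b * enorm v.
Proof.
move=> b0 fb; rewrite -ler_sqr ?nnegrE ?mulr_ge0 ?enorm_ge0 // exprMn.
rewrite !sqr_enorm mulr_sumr; apply: ler_sum => j _.
rewrite horner_sqr_diag exprMn ler_wpM2r ?sqr_ge0 //.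
by rewrite -[leLHS]real_normK ?num_real // ler_sqr ?nnegrE.
Qed.

Lemma horner_sqr_diag_ge (R : realType) n (d : 'rV[R]_n.+1) (f : {poly R})
    (v : 'cV[R]_n.+1) (b : R) :
  0 <= b -> (forall j, b <= `|f.[d 0 j ^+ 2]|) ->
  b * enorm v <= enorm (horner_mx (diag_mx d ^+ 2) f *m v).
Proof.
move=> b0 fb; rewrite -ler_sqr ?nnegrE ?mulr_ge0 ?enorm_ge0 // exprMn.
rewrite !sqr_enorm mulr_sumr; apply: ler_sum => j _.
rewrite horner_sqr_diag exprMn ler_wpM2r ?sqr_ge0 //.
by rewrite -[leRHS]real_normK ?num_real // ler_sqr ?nnegrE.
Qed.

(** [max_abs] is a supremum, which bounds the values only because a continuous
    function on a segment is bounded. *)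
Lemma le_max_abs (R : realType) (p : {poly R}) (b t : R) :
  0 <= t <= b -> `|p.[t]| <= max_abs p b.
Proof.
move=> tb; apply: ub_le_sup; last by exists t.
have b0 : 0 <= b by case/andP: tb; exact: le_trans.
have [|c _ cmax] := @EVT_max R (fun t => `|p.[t]|) 0 b b0.
  apply: continuous_subspaceT => s; apply: continuous_comp.
    exact: continuous_horner.
  exact: norm_continuous.
by exists `|p.[c]| => _ [s sb <-]; apply: cmax.
Qed.

(** * The iterates as polynomials in the Gram matrix *)

Lemma gram_power (R : realType) m n (A : 'M[R]_(m, n.+1)) (y : 'cV[R]_n.+1) j :
  A^T *m ((A *m A^T) ^+ j *m (A *m y)) = (A^T *m A) ^+ j.+1 *m y.
Proof.
elim: j => [|j IH]; first by rewrite expr0 mul1mx expr1 mulmxA.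
rewrite exprS [in RHS]exprS -![_ * _]/(_ *m _) -[in RHS]mulmxA -IH.
by rewrite !mulmxA.
Qed.

(** Together with the converse below: the affine space [y - A^T U_i] in which the
    iterate lives consists of the vectors [f (A^T A) y] with [f] in [Psi i], so
    that both minimization problems run over one set of vectors. *)
Lemma krylov_to_poly (R : realType) m n (A : 'M[R]_(m, n.+1)) (y : 'cV[R]_n.+1)
    i (z : 'cV[R]_m) :
  z \in krylov A y i ->
  exists2 f, Psi i f & y - A^T *m z = horner_mx (A^T *m A) f *m y.
Proof.
move=> /(@coord_span _ _ _ (in_tuple _)).
set c := coord _ => zE.
have sz : size [seq (A *m A^T) ^+ j *m (A *m y) | j <- iota 0 i] = i.
  by rewrite size_map size_iota.
exists (1 - \sum_j c j z *: 'X^(j.+1)).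
  split.
    apply: (leq_trans (size_polyD _ _)); rewrite geq_max size_poly1 size_polyN.
    apply: (leq_trans (size_sum _ _ _)); apply/bigmax_leqP => j _.
    by rewrite (leq_trans (size_scale_leq _ _)) // size_polyXn ltnS -[leqRHS]sz.
  rewrite !hornerE horner_sum big1 ?subr0 // => j _.
  by rewrite hornerZ hornerXn expr0n mulr0.
rewrite rmorphB rmorph1 mulmxBl mul1mx; congr (_ - _).
rewrite {1}zE mulmx_sumr rmorph_sum mulmx_suml; apply: eq_bigr => j _.
have ji : (j < i)%N by rewrite -[ltnRHS]sz.
rewrite -scalemxAr (nth_map 0%N) ?size_iota // nth_iota // add0n gram_power.
by rewrite /= horner_mxZ rmorphXn /= horner_mx_X -scalemxAl.
Qed.

Lemma poly_to_krylov (R : realType) m n (A : 'M[R]_(m, n.+1)) (y : 'cV[R]_n.+1)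
    i f :
  Psi i f -> exists2 z : 'cV[R]_m, z \in krylov A y i &
                y - A^T *m z = horner_mx (A^T *m A) f *m y.
Proof.
move=> [sf f0].
(* The sign makes up for the minus sign in [y - A^T z]. *)
exists (- \sum_(j < i) f`_j.+1 *: ((A *m A^T) ^+ j *m (A *m y))).
  rewrite rpredN; apply: rpred_sum => j _; apply/rpredZ/memv_span.
  by apply/mapP; exists (val j); rewrite // mem_iota /=.
have fE : f = 1 + \sum_(j < i) f`_j.+1 *: 'X^(j.+1).
  (* The sum over the coefficients of [f] is padded to exactly [i.+1] terms. *)
  rewrite -[LHS]coefK (poly_def (size f)).
  rewrite -(big_mkord xpredT (fun j => f`_j *: 'X^j)).
  rewrite (@big_nat_widen _ _ _ 0 _ i.+1) //=.
  rewrite big_mkcond big_mkord big_ord_recl; congr (_ + _).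
    case: ltnP => [_|]; first by rewrite -horner_coef0 f0 scale1r expr0.
    rewrite leqn0 size_poly_eq0 => /eqP f_0.
    by move/eqP: f0; rewrite f_0 horner0 eq_sym oner_eq0.
  apply: eq_bigr => j _; case: ltnP => // /(nth_default 0).
  by rewrite lift0 => ->; rewrite scale0r.
rewrite mulmxN opprK mulmx_sumr [in RHS]fE rmorphD rmorph1 mulmxDl mul1mx.
congr (_ + _); rewrite rmorph_sum mulmx_suml; apply: eq_bigr => j _.
rewrite -scalemxAr gram_power.
by rewrite /= horner_mxZ rmorphXn /= horner_mx_X -scalemxAl.
Qed.

(** A shortest vector of that affine space is unique by convexity, so any
    minimizing polynomial produces the iterate, even where the polynomial
    itself is not unique. *)
Lemma iterate_minimizing_poly (R : realType) m n (A : 'M[R]_(m, n.+1))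
    (y x : 'cV[R]_n.+1) i psi :
  lsqrnv_iterate A y i x -> minimizing_poly (A^T *m A) y i psi ->
  x = horner_mx (A^T *m A) psi *m y.
Proof.
move=> [z [[zK zmin] xE]] [psiP psimin].
pose S : set 'cV[R]_n.+1 :=
  [set u | exists2 f, Psi i f & u = horner_mx (A^T *m A) f *m y]%classic.
have [f fP fE] := krylov_to_poly zK.
apply: (@shortest_uniq _ _ S).
- exists (2^-1 *: (f + psi)); last first.
    by rewrite xE fE linearZ rmorphD /= -scalemxAl mulmxDl.
  case: fP psiP => sf f0 [sp p0]; split.
    apply: (leq_trans (size_scale_leq _ _)).
    by rewrite (leq_trans (size_polyD _ _)) // geq_max sf.
  by rewrite hornerZ hornerD f0 p0; field.
- split; first by exists f; rewrite ?xE.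
  move=> _ [h /(poly_to_krylov A y)[z' z'K <-] ->].
  by rewrite xE; apply: zmin.
split; first by exists psi.
by move=> _ [h hP ->]; apply: psimin.
Qed.

(** * The two blocks of a vector polynomial in the Gram matrix *)

Lemma horner_gram_blocks (R : realType) (m l k : nat)
    (A : 'M[R]_(m, l.+1 + k.+1)) sigma (W : 'M[R]_(l.+1 + k.+1)) (f : {poly R})
    (y : 'cV[R]_(l.+1 + k.+1)) : right_singular_vectors A sigma W ->
  (W_l W)^T *m (horner_mx (A^T *m A) f *m y)
    = horner_mx (Sigma_l sigma ^+ 2) f *m ((W_l W)^T *m y) /\
  (W_eps W)^T *m (horner_mx (A^T *m A) f *m y)
    = horner_mx (Sigma_eps sigma ^+ 2) f *m ((W_eps W)^T *m y).
Proof.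
move=> [/W_orth_blocks[ll le el ee] AE]; split; rewrite !mulmxA; congr (_ *m y).
- apply: horner_mx_intertwine.
  by rewrite AE mulmxDr !mulmxA ll le !mul0mx mul1mx addr0.
apply: horner_mx_intertwine.
by rewrite AE mulmxDr !mulmxA el ee !mul0mx mul1mx add0r.
Qed.

(** On the small singular values a residual polynomial is 1 up to [t p(t)], so it
    hardly damps the numerical null space; this is where [Delta eps^2] comes
    from. *)
Lemma residual_bounds (R : realType) (f p : {poly R}) (e D t : R) :
  f = 1 + 'X * p -> max_abs p (e ^+ 2) <= D -> 0 <= t <= e ^+ 2 ->
  1 - D * e ^+ 2 <= `|f.[t]| <= 1 + D * e ^+ 2.
Proof.
move=> -> pD te; have pt := le_trans (le_max_abs p te) pD.
have -> : (1 + 'X * p).[t] = 1 + t * p.[t] by rewrite !hornerE.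
have : `|t * p.[t]| <= D * e ^+ 2.
  case/andP: te => t0 te.
  by rewrite normrM (ger0_norm t0) mulrC ler_pM.
move: (t * p.[t]) (D * e ^+ 2) => u v uv.
apply/andP; split.
  by have := lerB_normD 1 u; rewrite normr1; lra.
by have := ler_normD 1 u; rewrite normr1; lra.
Qed.

Lemma le_of_sqr_add (R : realType) (s a b : R) : 0 <= a -> 0 <= b ->
  s ^+ 2 <= a ^+ 2 + b ^+ 2 -> s <= a + b.
Proof. by move=> a0 b0 sab; rewrite leNgt; apply/negP => lts; nra. Qed.

(** The polynomial [f] wins over [g] on the two blocks together. On the null space
    block [g] can lose at most [(1 + v)^2 - (1 - v)^2 = 4 v] times the squared
    norm to [f], so on the range block [f] can lose no more than that to [g].
    The square root of [4 v] gives the second term of the bound. *)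
Lemma W_l_block_bound (R : realType) (m l k : nat)
    (A : 'M[R]_(m, l.+1 + k.+1)) sigma (W : 'M[R]_(l.+1 + k.+1))
    (y : 'cV[R]_(l.+1 + k.+1)) (f g : {poly R}) (v : R) :
  right_singular_vectors A sigma W -> 0 <= v < 1 ->
  enorm (horner_mx (A^T *m A) f *m y) <= enorm (horner_mx (A^T *m A) g *m y) ->
  (1 - v) * enorm ((W_eps W)^T *m y)
    <= enorm (horner_mx (Sigma_eps sigma ^+ 2) f *m ((W_eps W)^T *m y)) ->
  enorm (horner_mx (Sigma_eps sigma ^+ 2) g *m ((W_eps W)^T *m y))
    <= (1 + v) * enorm ((W_eps W)^T *m y) ->
  enorm (horner_mx (Sigma_l sigma ^+ 2) f *m ((W_l W)^T *m y))
    <= enorm (horner_mx (Sigma_l sigma ^+ 2) g *m ((W_l W)^T *m y))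
       + 2 * Num.sqrt v * enorm ((W_eps W)^T *m y).
Proof.
move=> rsv /andP[v0 v1]; rewrite enorm_le_sqr.
rewrite !(sqr_enorm_split (proj1 rsv)).
have [-> ->] := horner_gram_blocks f y rsv.
have [-> ->] := horner_gram_blocks g y rsv.
set H := enorm ((W_eps W)^T *m y).
have H0 : 0 <= H by exact: enorm_ge0.
move=> fg fH gH; apply: le_of_sqr_add.
- exact: enorm_ge0.
- by rewrite !mulr_ge0 // sqrtr_ge0.
rewrite !exprMn (sqr_sqrtr v0).
have f2 : (1 - v) ^+ 2 * H ^+ 2
    <= enorm (horner_mx (Sigma_eps sigma ^+ 2) f *m ((W_eps W)^T *m y)) ^+ 2.
  by rewrite -exprMn ler_sqr ?nnegrE ?enorm_ge0 // mulr_ge0 // subr_ge0 ltW.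
have g2 : enorm (horner_mx (Sigma_eps sigma ^+ 2) g *m ((W_eps W)^T *m y)) ^+ 2
    <= (1 + v) ^+ 2 * H ^+ 2.
  by rewrite -exprMn ler_sqr ?nnegrE ?enorm_ge0 // mulr_ge0 // addr_ge0.
by lra.
Qed.

(** On the large singular values, the Chebyshev competitor bounds the minimum. *)
Lemma min_block_bound (R : realType) n (d : 'rV[R]_n.+1) (g : 'cV[R]_n.+1)
    (c : R) i (f : {poly R}) : 0 < c -> (forall j, c <= d 0 j <= 1) ->
  minimizing_poly (diag_mx d ^+ 2) g i f ->
  enorm (horner_mx (diag_mx d ^+ 2) f *m g)
    <= 2 * ((1 - c) / (1 + c)) ^+ i * enorm g.
Proof.
move=> c0 cd [_ fmin].
have c1 : c <= 1 by case/andP: (cd 0); exact: le_trans.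
have [|q qP qle] := @small_residual_poly R i c; first by rewrite c0.
apply: (le_trans (fmin q qP)); apply: horner_sqr_diag_le.
  by rewrite mulr_ge0 // exprn_ge0 // divr_ge0; lra.
by move=> j; apply: qle; case/andP: (cd j) => *; nra.
Qed.

Theorem theorem3p2 (R : realType) (m l k : nat)
    (A : 'M[R]_(m, l.+1 + k.+1)) (sigma : (l.+1 + k.+1).-tuple R)
    (W : 'M[R]_(l.+1 + k.+1)) (y x : 'cV[R]_(l.+1 + k.+1)) (i : nat)
    (psi psih phi phih : {poly R}) :
  let kappa := sigma`_0 / sigma`_l in
  let eps := sigma`_l.+1 / sigma`_0 in
  let Delta := Num.max (max_abs phi (eps ^+ 2)) (max_abs phih (eps ^+ 2)) in
  singular_values A sigma ->
  sigma`_0 = 1 ->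
  sigma`_l.+1 < sigma`_l ->
  right_singular_vectors A sigma W ->
  enorm y = 1 ->
  y \notin range_space W ->
  (1 <= i)%N ->
  reached A y i ->
  lsqrnv_iterate A y i x ->
  minimizing_poly (A^T *m A) y i psi ->
  minimizing_poly (Sigma_l sigma ^+ 2) ((W_l W)^T *m y) i psih ->
  (size phi <= i)%N -> psi = 1 + 'X * phi ->
  (size phih <= i)%N -> psih = 1 + 'X * phih ->
  Delta * eps ^+ 2 < 1 ->
  sin (angle W x) <=
    2 * tan (angle W y) / (1 - Delta * eps ^+ 2)
      * ((kappa - 1) / (kappa + 1)) ^+ i
    + 2 * Num.sqrt Delta * eps / (1 - Delta * eps ^+ 2).
Proof.
move=> kappa eps Delta [_ s_ge0 s_sorted] s0 gap rsv y1 yR _ _ itx psiP psihP.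
move=> _ psiE _ psihE De1.
have epsE : eps = sigma`_l.+1 by rewrite /eps s0 divr1.
have sz : size sigma = (l.+1 + k.+1)%N by rewrite size_tuple.
have s_le a b : (a <= b)%N -> (b < l.+1 + k.+1)%N -> sigma`_b <= sigma`_a.
  move=> ab bN.
  have geT : transitive (fun s t : R => t <= s) by move=> u t w tu wt; exact: le_trans tu.
  apply: (sorted_leq_nth geT _ 0 s_sorted) => //; rewrite inE sz //.
  exact: leq_ltn_trans bN.
have s_nn a : (a < l.+1 + k.+1)%N -> 0 <= sigma`_a.
  by move=> aN; apply: (allP s_ge0); rewrite mem_nth ?sz.
have eps0 : 0 <= eps by rewrite epsE s_nn // -[ltnLHS]addn0 ltn_add2l.
have c0 : 0 < sigma`_l by apply: le_lt_trans gap; rewrite -epsE.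
have D0 : 0 <= Delta.
  rewrite le_max; apply/orP; left; apply: le_trans (le_max_abs (t := 0) phi _).
    exact: normr_ge0.
  by rewrite lexx sqr_ge0.
have small j : 0 <= (\row_(j < k.+1) sigma`_(l.+1 + j)) 0 j ^+ 2 <= eps ^+ 2.
  have jN : (l.+1 + j < l.+1 + k.+1)%N by rewrite ltn_add2l.
  rewrite sqr_ge0 mxE ler_sqr ?nnegrE //; last exact: s_nn.
  by rewrite epsE; apply: s_le; rewrite ?leq_addr.
have phi_D : max_abs phi (eps ^+ 2) <= Delta by rewrite le_max lexx.
have phih_D : max_abs phih (eps ^+ 2) <= Delta by rewrite le_max lexx orbT.
have psi_b j := residual_bounds psiE phi_D (small j).
have psih_b j := residual_bounds psihE phih_D (small j).
pose r := ((kappa - 1) / (kappa + 1)) ^+ i.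
set G := enorm ((W_l W)^T *m y); set H := enorm ((W_eps W)^T *m y).
have H0 : 0 < H by exact: (notin_range_space (proj1 rsv) yR).
(* The Chebyshev rate is stated for the reciprocal of [kappa]. *)
have head_b : enorm (horner_mx (Sigma_l sigma ^+ 2) psih *m ((W_l W)^T *m y))
    <= 2 * r * G.
  have -> : r = ((1 - sigma`_l) / (1 + sigma`_l)) ^+ i.
    by congr (_ ^+ _); rewrite /kappa s0; field; apply/andP; split; apply/eqP; lra.
  apply: min_block_bound psihP => // j.
  rewrite mxE -s0; apply/andP; split; apply: s_le => //.
  - exact: leq_ord.
  - exact: leq_addr.
  exact: leq_trans (ltn_ord j) (leq_addr _ _).
have xE := iterate_minimizing_poly itx psiP.
have [xl xe] := horner_gram_blocks psi y rsv.
have tail_b : (1 - Delta * eps ^+ 2) * H <= enorm ((W_eps W)^T *m x).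
  rewrite xE xe; apply: horner_sqr_diag_ge; first by rewrite subr_ge0 ltW.
  by move=> j; case/andP: (psi_b j).
have tailh_b : enorm (horner_mx (Sigma_eps sigma ^+ 2) psih *m ((W_eps W)^T *m y))
    <= (1 + Delta * eps ^+ 2) * H.
  apply: horner_sqr_diag_le; first by rewrite addr_ge0 // mulr_ge0 // sqr_ge0.
  by move=> j; case/andP: (psih_b j).
have xl_b : enorm ((W_l W)^T *m x)
    <= 2 * r * G + 2 * (Num.sqrt Delta * eps) * H.
  have -> : Num.sqrt Delta * eps = Num.sqrt (Delta * eps ^+ 2).
    by rewrite sqrtrM // sqrtr_sqr ger0_norm.
  rewrite xE xl; apply: le_trans (lerD head_b (lexx _)).
  apply: (W_l_block_bound rsv) => //.
  - by rewrite De1 mulr_ge0 // sqr_ge0.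
  - exact: (psiP.2 _ psihP.1).
  - by rewrite -xe -xE.
have De0 : 0 < 1 - Delta * eps ^+ 2 by rewrite subr_gt0.
have x_b : (1 - Delta * eps ^+ 2) * H <= enorm x.
  exact: le_trans tail_b (enorm_W_eps_le (proj1 rsv) x).
have x0 : 0 < enorm x by apply: lt_le_trans x_b; rewrite mulr_gt0.
rewrite (sin_angle (proj1 rsv)) // (tan_angle (proj1 rsv)) ?y1 // -/G -/H -/r.
apply: (@le_trans _ _ ((2 * r * G + 2 * (Num.sqrt Delta * eps) * H)
                        / ((1 - Delta * eps ^+ 2) * H))); last first.
  rewrite le_eqVlt; apply/orP; left; apply/eqP.
  by field; rewrite !gt_eqF.
apply: ler_pM => //; rewrite ?enorm_ge0 ?invr_ge0 ?(ltW x0) //.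
by rewrite lef_pV2 ?posrE ?mulr_gt0.
Qed.
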